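(* Let $\sigma$ be a unit vector field on an $n$-dimensional Riemannian manifold $(M,g)$. If the integral curves of $\sigma$ are geodesics, then for any vector field $\alpha$ on $M$ pointwise orthogonal to $\sigma$ we have, at every point, $$(n-1)\,|L_\alpha g|^2\ \geq\ 4(\operatorname{div}\alpha)^2.$$
   Context: $L_\alpha g$ is the Lie derivative of the metric, and $|L_\alpha g|^2=\sum_{i,j}(L_\alpha g)(E_i,E_j)^2$ for any local orthonormal frame $\{E_i\}$. All fields are smooth. *)

(* Defs.v *)
(* Smooth n-manifolds without boundary, given by an atlas of charts into
   'rV[R]_n.  Tensor fields are represented by their components in every chart
   of the atlas, as functions of the coordinates x : 'rV_n, subject to the usual
   transformation law; the values of such functions outside the image of the
   chart are irrelevant junk.  A tangent vector is a row vector of components. *)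
From HB Require Import structures.
From mathcomp Require Import all_boot all_order all_algebra.
From mathcomp Require Import all_classical all_reals all_analysis.
Set Implicit Arguments.
Unset Strict Implicit.
Unset Printing Implicit Defensive.
Import Order.TTheory GRing.Theory Num.Theory.
Import numFieldNormedType.Exports.
Local Open Scope classical_set_scope.
Local Open Scope ring_scope.

(* To be used on open sets U only: the derivatives at x \in U are those of the
   total function f, which then depend only on the restriction of f to U. *)
Fixpoint Ck_on (R : realType) (V W : normedModType R) (k : nat) (U : set V)
    (f : V -> W) : Prop :=
  if k is k'.+1 then
    (forall x, U x -> differentiable f x) /\
    (forall v, Ck_on k' U (fun x => 'D_v f x))
  else forall x, U x -> {for x, continuous f}.

Definition smooth_on (R : realType) (V W : normedModType R) (U : set V)
    (f : V -> W) : Prop := forall k, Ck_on k U f.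

(* A chart is a homeomorphism from an open subset of M to an open subset of
   R^n; both directions are totalised, with junk values outside. *)
Record chart (R : realType) (n : nat) (M : topologicalType) := Chart {
  chart_dom : set M;
  chart_map : M -> 'rV[R]_n;
  chart_inv : 'rV[R]_n -> M;
  chart_dom_open : open chart_dom;
  chart_img_open : open (chart_map @` chart_dom);
  chart_mapK : forall p, chart_dom p -> chart_inv (chart_map p) = p;
  chart_map_cont : forall p, chart_dom p -> {for p, continuous chart_map};
  chart_inv_cont : forall x, (chart_map @` chart_dom) x ->
    {for x, continuous chart_inv}
}.

Definition chart_img (R : realType) (n : nat) (M : topologicalType)
    (phi : chart R n M) (W : set M) : set 'rV[R]_n :=
  chart_map phi @` (chart_dom phi `&` W).

Definition transition (R : realType) (n : nat) (M : topologicalType)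
    (phi psi : chart R n M) : 'rV[R]_n -> 'rV[R]_n :=
  chart_map psi \o chart_inv phi.

Record manifold (R : realType) (n : nat) := Manifold {
  manifold_space :> topologicalType;
  atlas : set (chart R n manifold_space);
  manifold_hausdorff : hausdorff_space manifold_space;
  manifold_second_countable : @second_countable manifold_space;
  atlas_cover : forall p, exists2 phi, atlas phi & chart_dom phi p;
  atlas_compat : forall phi psi, atlas phi -> atlas psi ->
    smooth_on (chart_img phi (chart_dom psi)) (transition phi psi)
}.

(* Smooth vector fields on the (open) subset W of M. *)
Record vector_field_on (R : realType) (n : nat) (M : manifold R n)
    (W : set M) := VectorField {
  vf_comp :> chart R n M -> 'rV[R]_n -> 'rV[R]_n;
  vf_smooth : forall phi, atlas phi ->
    smooth_on (chart_img phi W) (vf_comp phi);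
  vf_transform : forall phi psi, atlas phi -> atlas psi ->
    forall x, chart_img phi (chart_dom psi `&` W) x ->
    vf_comp psi (transition phi psi x) = 'd (transition phi psi) x (vf_comp phi x)
}.

Notation vector_field M := (@vector_field_on _ _ M setT).

Definition bilin (R : realType) (n : nat) (G : 'M[R]_n) (v w : 'rV[R]_n) : R :=
  (v *m G *m w^T) 0 0.

Record riemannian_metric (R : realType) (n : nat) (M : manifold R n) :=
  RiemannianMetric {
  metric_comp :> chart R n M -> 'rV[R]_n -> 'M[R]_n;
  metric_smooth : forall phi, atlas phi ->
    smooth_on (chart_img phi setT) (metric_comp phi);
  metric_sym : forall phi, atlas phi -> forall x, chart_img phi setT x ->
    (metric_comp phi x)^T = metric_comp phi x;
  metric_pos : forall phi, atlas phi -> forall x, chart_img phi setT x ->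
    forall v, v != 0 -> 0 < bilin (metric_comp phi x) v v;
  metric_transform : forall phi psi, atlas phi -> atlas psi ->
    forall x, chart_img phi (chart_dom psi) x -> forall v w,
    bilin (metric_comp phi x) v w =
    bilin (metric_comp psi (transition phi psi x))
      ('d (transition phi psi) x v) ('d (transition phi psi) x w)
}.

Section Geometry.
Context (R : realType) (n : nat) (M : manifold R n) (g : riemannian_metric M).
Implicit Types (phi : chart R n M) (x v w : 'rV[R]_n) (W : set M).

(* The function g(X, Y), read in the chart phi. *)
Definition inner W1 W2 (X : vector_field_on W1) (Y : vector_field_on W2)
    phi x : R := bilin (g phi x) (X phi x) (Y phi x).

Definition unit_field W (X : vector_field_on W) : Prop :=
  forall phi, atlas phi -> forall x, chart_img phi W x -> inner X X phi x = 1.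

Definition orthogonal_fields W (X Y : vector_field_on W) : Prop :=
  forall phi, atlas phi -> forall x, chart_img phi W x -> inner X Y phi x = 0.

Definition orthonormal_frame W (E : 'I_n -> vector_field_on W) : Prop :=
  forall phi, atlas phi -> forall x, chart_img phi W x ->
  forall i j, inner (E i) (E j) phi x = (i == j)%:R.

(* partial_metric phi x l i j = d(g_ij)/dx_l *)
Definition partial_metric phi x (l i j : 'I_n) : R :=
  ('D_(delta_mx 0 l) (g phi) x) i j.

(* Gamma^k_ij of the Levi-Civita connection *)
Definition christoffel phi x (k i j : 'I_n) : R :=
  2^-1 * \sum_l invmx (g phi x) k l *
    (partial_metric phi x i j l + partial_metric phi x j i l
     - partial_metric phi x l i j).

Definition christoffel_form phi x v w : 'rV[R]_n :=
  \row_k \sum_i \sum_j christoffel phi x k i j * v 0 i * w 0 j.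

(* Levi-Civita covariant derivative of X in the direction v *)
Definition nabla W (X : vector_field_on W) phi x v : 'rV[R]_n :=
  'D_v (X phi) x + christoffel_form phi x v (X phi x).

(* trace of the endomorphism v |-> nabla_v X *)
Definition divergence W (X : vector_field_on W) phi x : R :=
  \sum_(i < n) nabla X phi x (delta_mx 0 i) 0 i.

Definition lie_bracket W1 W2 (X : vector_field_on W1) (Y : vector_field_on W2)
    phi x : 'rV[R]_n :=
  'D_(X phi x) (Y phi) x - 'D_(Y phi x) (X phi) x.

(* (L_X g)(Y, Z) = X (g(Y, Z)) - g([X, Y], Z) - g(Y, [X, Z]) *)
Definition lie_metric W0 W (X : vector_field_on W0) (Y Z : vector_field_on W)
    phi x : R :=
  'D_(X phi x) (inner Y Z phi) x
  - bilin (g phi x) (lie_bracket X Y phi x) (Z phi x)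
  - bilin (g phi x) (Y phi x) (lie_bracket X Z phi x).

(* |L_X g|^2, computed in the local orthonormal frame E *)
Definition lie_metric_sqnorm W0 W (X : vector_field_on W0)
    (E : 'I_n -> vector_field_on W) phi x : R :=
  \sum_(i < n) \sum_(j < n) lie_metric X (E i) (E j) phi x ^+ 2.

Definition open_interval (I : set R) : Prop := open I /\ is_interval I.

Definition integral_curve (X : vector_field M) (I : set R) (c : R -> M) : Prop :=
  forall t, I t -> {for t, continuous c} /\
  forall phi, atlas phi -> chart_dom phi (c t) ->
    is_derive t 1 (chart_map phi \o c) (X phi (chart_map phi (c t))).

(* The geodesic equation x'' + Gamma(x', x') = 0 in every chart; as usual,
   C^oo regularity of c follows from it. *)
Definition geodesic (I : set R) (c : R -> M) : Prop :=
  forall t, I t -> {for t, continuous c} /\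
  forall phi, atlas phi -> chart_dom phi (c t) ->
    let x := chart_map phi \o c in
    [/\ \forall s \near t, derivable x s 1,
        derivable (derive1 x) t 1 &
        derive1 (derive1 x) t + christoffel_form phi (x t) (derive1 x t) (derive1 x t) = 0].

End Geometry.

(* Main.v *)
Require Import Defs.
From HB Require Import structures.
From mathcomp Require Import all_boot all_order all_algebra.
From mathcomp Require Import all_classical all_reals all_analysis.
From mathcomp Require Import ring lra.
Set Implicit Arguments.
Unset Strict Implicit.
Unset Printing Implicit Defensive.
Import Order.TTheory GRing.Theory Num.Theory.
Import numFieldNormedType.Exports.
Local Open Scope classical_set_scope.
Local Open Scope ring_scope.

(* The curves of sigma being geodesics means nabla_sigma sigma = 0, once one
   knows that an integral curve passes through every point (Picard-Lindelof).
   Together with g(alpha, sigma) = 0 this gives (L_alpha g)(sigma, sigma) =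
   2 g(nabla_sigma alpha, sigma) = -2 g(alpha, nabla_sigma sigma) = 0.  As the
   trace of L_alpha g is 2 div alpha, it is the Frobenius product of L_alpha g
   with the orthogonal projection onto the complement of sigma, whose squared
   norm is n - 1, and Cauchy-Schwarz concludes. *)

(** * Calculus of row vectors over the reals: norms, limits, antiderivatives, mean value bounds *)

Section RowVectors.
Context {R : realType}.

Lemma row_norm_le n (x : 'rV[R]_n) (e : R) :
  0 <= e -> (forall i, `|x 0 i| <= e) -> `|x| <= e.
Proof.
move=> e0 xe; rewrite /Num.Def.normr/= mx_normrE.
by rewrite (bigmax_le _ e0)//= => -[i j] _; rewrite ord1; exact: xe.
Qed.

Lemma norm_coord_le n (x : 'rV[R]_n) i : `|x 0 i| <= `|x|.
Proof.
rewrite [leRHS]/Num.Def.normr/= mx_normrE.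
exact: (le_bigmax _ (fun ij : 'I_1 * 'I_n => `|x ij.1 ij.2|) (0, i)).
Qed.

Lemma is_derive_mxP (V : normedModType R) m n (A : V -> 'M[R]_(m, n)) x v dA :
  is_derive x v A dA <->
  forall i j, is_derive x v (fun y => A y i j) (dA i j).
Proof.
split=> [[dvA <-] i j|dvA].
  by apply: DeriveDef; [move/derivable_mxP: dvA; exact|rewrite derive_mx// mxE].
have dA' : derivable A x v by apply/derivable_mxP => i j; have [] := dvA i j.
apply: DeriveDef => //; rewrite derive_mx//; apply/matrixP => i j.
by rewrite mxE; have [] := dvA i j.
Qed.

Lemma near_norm_lt (a t : R) : `|t| < a -> \forall s \near t, `|s| < a.
Proof. by move=> ta; exact: (@cvgr_norm_lt _ _ _ _ _ id t cvg_id a ta). Qed.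

(** The powers of 2 are unbounded, so the error term can be made smaller than any positive gap
    [x - y]. This passes estimates on the Picard iterates to their limit. *)
Lemma le_of_le_add_geometric (x y C : R) :
  (forall k, x <= y + C / 2 ^+ k) -> x <= y.
Proof.
move=> xy; rewrite leNgt; apply/negP => yx.
have xy0 : 0 < x - y by rewrite subr_gt0.
have [k] : exists k : nat, C < (x - y) * 2 ^+ k.
  exists (Num.truncn (`|C| / (x - y))).+1.
  rewrite mulrC -ltr_pdivrMr//.
  apply: (@le_lt_trans _ _ (`|C| / (x - y))).
    by rewrite ler_pM2r ?invr_gt0// ler_norm.
  apply: (@lt_le_trans _ _ (Num.truncn (`|C| / (x - y))).+1%:R).
    by rewrite truncnS_gt.
  by rewrite -natrX ler_nat ltnW// ltn_expl.
rewrite -ltr_pdivrMr ?exprn_gt0// => h.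
by have := xy k; lra.
Qed.

(* The intervals [y k - 2C/2^k, y k + 2C/2^k] are nested. *)
Lemma geometric_limit (y : nat -> R) (C : R) :
  (forall k, `|y k.+1 - y k| <= C / 2 ^+ k) ->
  exists l, forall k, `|l - y k| <= 2 * C / 2 ^+ k.
Proof.
move=> hy.
pose z k := y k - 2 * C / 2 ^+ k; pose w k := y k + 2 * C / 2 ^+ k.
have hS k : 2 * C / 2 ^+ k.+1 = C / 2 ^+ k :> R.
  by rewrite exprS; field; rewrite expf_neq0.
have hk k : 2 * C / 2 ^+ k = C / 2 ^+ k + C / 2 ^+ k by lra.
have zS k : z k <= z k.+1.
  by rewrite /z hS hk; have := hy k; rewrite ler_norml; lra.
have wS k : w k.+1 <= w k.
  by rewrite /w hS hk; have := hy k; rewrite ler_norml; lra.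
have C0 k : 0 <= C / 2 ^+ k by apply: le_trans (hy k).
have zz k m : (k <= m)%N -> z k <= z m.
  by apply: (@homo_leq _ z (fun a b => a <= b)) => // a b c; exact: le_trans.
have ww k m : (k <= m)%N -> w m <= w k.
  by apply: (@homo_leq _ w (fun a b => b <= a)) => // a b c ab /le_trans; apply.
have zw k m : z k <= w m.
  apply: (le_trans (zz _ _ (leq_maxl k m))).
  apply: le_trans (ww _ _ (leq_maxr k m)).
  by rewrite /z /w hk; have := C0 (maxn k m); lra.
have supz : has_sup (range z).
  by split; [exists (z 0), 0%N | exists (w 0) => _ [k _ <-]].
exists (sup (range z)) => k.
have zk : z k <= sup (range z) by apply: sup_upper_bound => //; exists k.
have wk : sup (range z) <= w k.
  by apply: ge_sup => [|_ [j _ <-]] //; exists (z 0), 0%N.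
by move: zk wk; rewrite ler_norml /z /w; lra.
Qed.

Lemma row_geometric_limit n (y : nat -> 'rV[R]_n) (C : R) : 0 <= C ->
  (forall k, `|y k.+1 - y k| <= C / 2 ^+ k) ->
  exists l, forall k, `|l - y k| <= 2 * C / 2 ^+ k.
Proof.
move=> C0 hy.
have /choice[l hl] (i : 'I_n) :
    exists l, forall k, `|l - y k 0 i| <= 2 * C / 2 ^+ k.
  apply: geometric_limit => k; apply: le_trans (hy k).
  by have := norm_coord_le (y k.+1 - y k) i; rewrite !mxE.
exists (\row_i l i) => k; apply: row_norm_le => [|i]; last by rewrite !mxE.
by rewrite divr_ge0 ?exprn_ge0 ?mulr_ge0.
Qed.

(** Integration starts at -1, so that every [t] with |t| < 1 is interior to the interval on which
    the fundamental theorem of calculus is applied. *)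
Lemma real_antiderivative (h : R -> R) : continuous h ->
  exists H : R -> R, forall t : R, `|t| < 1 -> is_derive t 1 H (h t).
Proof.
move=> ch; exists (fun t : R => \int[lebesgue_measure]_(s in `[-1, t]) h s) => t.
rewrite ltr_norml => /andP[t1 t2].
have ih : lebesgue_measure.-integrable `[(-1 : R), 1] (EFin \o h).
  apply: continuous_compact_integrable; first exact: segment_compact.
  exact: continuous_subspaceT.
have [d e] := continuous_FTC1_closed t2 ih t1 (ch t).
by apply: (DeriveDef d); rewrite -derive1E.
Qed.

Lemma antiderivative n (h : R -> 'rV[R]_n) : continuous h ->
  exists H : R -> 'rV[R]_n,
    H 0 = 0 /\ forall t : R, `|t| < 1 -> is_derive t 1 H (h t).
Proof.
move=> ch.
have /choice[H hH] (i : 'I_n) : exists H : R -> R,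
    forall t : R, `|t| < 1 -> is_derive t 1 H (h t 0 i).
  apply: real_antiderivative => t.
  exact: (continuous_comp (ch t) (@coord_continuous _ _ _ 0 i (h t))).
exists (fun t => \row_i (H i t - H i 0)); split.
  by apply/rowP => i; rewrite !mxE subrr.
move=> t t1; apply/is_derive_mxP => i j; rewrite ord1.
have := hH j _ t1 => Hd.
rewrite (_ : (fun _ => _) = H j \- cst (H j 0)); last first.
  by apply/funext => y; rewrite mxE.
by apply: is_derive_eq; rewrite subr0.
Qed.

Lemma mean_value_real (f df : R -> R) (s t : R) : s <= t ->
  (forall u : R, s <= u <= t -> is_derive u 1 f (df u)) ->
  exists2 c, s <= c <= t & f t - f s = df c * (t - s).
Proof.
move=> st dfs.
have d1 (u : R) : u \in `]s, t[ -> is_derive u 1 f (df u).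
  by rewrite in_itv/= => /andP[su ut]; apply: dfs; rewrite !ltW.
have d2 : {within `[s, t], continuous f}.
  apply: derivable_within_continuous => u; rewrite in_itv/= => /dfs d.
  exact: ex_derive.
have [c] := MVT_segment st d1 d2.
by rewrite in_itv/= => sct eq; exists c.
Qed.

(** The intermediate point of the scalar mean value theorem depends on the coordinate. This is
    harmless for the sup norm, which is bounded one coordinate at a time. *)
Lemma mean_value_row n (H h : R -> 'rV[R]_n) (C s t : R) : s <= t ->
  (forall u : R, s <= u <= t -> is_derive u 1 H (h u)) ->
  (forall u : R, s <= u <= t -> `|h u| <= C) ->
  `|H t - H s| <= C * (t - s).
Proof.
move=> st dH hC.
have C0 : 0 <= C by apply: le_trans (hC s _); rewrite ?lexx.
apply: row_norm_le => [|i]; first by rewrite mulr_ge0 ?subr_ge0.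
have dHi (u : R) : s <= u <= t -> is_derive u 1 (fun x : R => H x 0 i) (h u 0 i).
  by move=> /dH /is_derive_mxP.
have [c cst e] := mean_value_real st dHi.
rewrite !mxE [X in `|X|]e normrM [`|t - s|]ger0_norm ?subr_ge0//.
by rewrite ler_wpM2r ?subr_ge0// (le_trans (norm_coord_le _ _))// hC.
Qed.

Lemma mean_value_row_ball n (H h : R -> 'rV[R]_n) (C s t : R) :
  (forall u : R, `|u| < 1 -> is_derive u 1 H (h u)) ->
  (forall u : R, `|u| < 1 -> `|h u| <= C) ->
  `|s| < 1 -> `|t| < 1 -> `|H t - H s| <= C * `|t - s|.
Proof.
move=> dH hC; wlog st : s t / s <= t.
  move=> hw s1 t1; have [|/ltW] := leP s t => st; first exact: hw.
  by rewrite distrC [`|t - s|]distrC; exact: hw.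
rewrite !ltr_norml => s1 t1.
have bd u : s <= u <= t -> `|u| < 1 by move=> sut; rewrite ltr_norml; lra.
rewrite [`|t - s|]ger0_norm ?subr_ge0//.
by apply: mean_value_row st _ _ => u /bd; [exact: dH|exact: hC].
Qed.

(** For [a <= b] this is the 1-Lipschitz retraction of the line onto [a, b]. It serves twice: to
    freeze time in the Picard operator, and coordinatewise to confine a point to a cube. *)
Definition clamp (a b t : R) : R := Num.max a (Num.min b t).

Lemma clamp_lipschitz a b s t : `|clamp a b s - clamp a b t| <= `|s - t|.
Proof.
wlog st : s t / s <= t.
  move=> hw; have [|/ltW] := leP s t => st; first exact: hw.
  by rewrite distrC [`|s - t|]distrC; exact: hw.
rewrite /clamp distrC [leRHS]distrC (ger0_norm (_ : 0 <= t - s)) ?subr_ge0//.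
rewrite ler_norml; case: (leP b s) => h1; case: (leP b t) => h2;
  repeat match goal with |- context [Num.max ?x ?y] => case: (leP x y) => ? end;
  lra.
Qed.

Lemma clamp_id a b t : a <= t <= b -> clamp a b t = t.
Proof. by move=> /andP[at_ tb]; rewrite /clamp min_r// max_r. Qed.

Lemma clamp_itv a b t : a <= b -> a <= clamp a b t <= b.
Proof.
by move=> ab; rewrite /clamp le_max lexx/= ge_max ab ge_min lexx.
Qed.

End RowVectors.

(** * The Picard-Lindelof theorem for bounded, globally Lipschitz fields *)

Section PicardLindelof.
Context {R : realType} {n : nat}.
Implicit Types (h c : R -> 'rV[R]_n) (F : 'rV[R]_n -> 'rV[R]_n).

Lemma lipschitz_continuous (V W : normedModType R) (f : V -> W) (L : R) :
  (forall x y, `|f x - f y| <= L * `|x - y|) -> continuous f.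
Proof.
move=> fL x; apply/cvgrPdist_le => /= e e0; near=> y.
apply: le_trans (fL x y) _.
have L1 : 0 < `|L| + 1 by rewrite ltr_pwDr.
apply: (@le_trans _ _ ((`|L| + 1) * `|x - y|)).
  by rewrite ler_wpM2r// (le_trans (ler_norm L))// lerDl.
rewrite -ler_pdivlMl//; near: y.
by apply: cvgr_dist_le; [exact: cvg_id|rewrite mulr_gt0 ?invr_gt0].
Unshelve. all: by end_near. Qed.

(* Freezing time outside [-a, a] makes the Picard operator contract the sup
   norm over the whole line. *)
Lemma picard_lindelof F (L B : R) (x0 : 'rV[R]_n) :
  (forall x y, `|F x - F y| <= L * `|x - y|) -> (forall x, `|F x| <= B) ->
  exists2 a : R, 0 < a & exists c : R -> 'rV[R]_n,
    c 0 = x0 /\ forall t : R, `|t| < a -> is_derive t 1 c (F (c t)).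
Proof.
move=> FL FB.
(* With L at least 1, the time a = 1/(2L) is below 1, hence inside the interval where
   antiderivatives are available; L a = 1/2 will be the contraction ratio. *)
wlog L1 : L FL / 1 <= L.
  move=> /(_ (Num.max 1 L)); apply; last by rewrite le_max lexx.
  by move=> x y; apply: le_trans (FL x y) _; rewrite ler_wpM2r// le_max lexx orbT.
have L0 : 0 < L by apply: lt_le_trans L1.
have B0 : 0 <= B by apply: le_trans (FB x0).
have cF : continuous F := lipschitz_continuous FL.
pose a := (2 * L)^-1.
have a0 : 0 < a by rewrite invr_gt0 mulr_gt0.
have aL : L * a = 2^-1 by rewrite /a invfM mulrCA divff ?mulr1// gt_eqF.
have a1 : a < 1 by rewrite invf_lt1 ?mulr_gt0//; lra.
(* Choice needs an antiderivative operator defined on all functions; a discontinuous [h] receives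
   the default value 0. *)
have /choice[A hA] h : exists H : R -> 'rV[R]_n, continuous h ->
    H 0 = 0 /\ forall t : R, `|t| < 1 -> is_derive t 1 H (h t).
  have [ch|] := pselect (continuous h); last by exists (fun=> 0).
  by have [H hH] := antiderivative ch; exists H.
pose k := clamp (- a) a.
have kb t : `|k t| <= a.
  by rewrite ler_norml; apply: clamp_itv; lra.
have k1 t : `|k t| < 1 by apply: le_lt_trans (kb t) a1.
have k0 : k 0 = 0 by rewrite /k clamp_id//; lra.
pose P c t := x0 + A (F \o c) (k t).
have cc c : continuous c -> continuous (F \o c).
  by move=> hc t; exact: (continuous_comp (hc t) (cF (c t))).
(* Every image under [P] is Lipschitz with the same constant B, so continuity survives the iteration
   and, later, the limit. *)
have PB c : continuous c -> forall s t, `|P c s - P c t| <= B * `|s - t|.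
  move=> hc s t; have [_ dA] := hA _ (cc _ hc).
  rewrite /P opprD addrACA subrr add0r.
  apply: le_trans (mean_value_row_ball dA (fun u _ => FB (c u)) (k1 _) (k1 _)) _.
  by rewrite ler_wpM2l// clamp_lipschitz.
(* The integrands differ by at most L e and time is at most a, so the images differ by at most L e a
   = e / 2. *)
have PC c c' e : continuous c -> continuous c' ->
    (forall t, `|c t - c' t| <= e) -> forall t, `|P c t - P c' t| <= e / 2.
  move=> hc hc' cc' t.
  have e0 : 0 <= e by apply: le_trans (cc' 0).
  have [A0 dA] := hA _ (cc _ hc); have [A0' dA'] := hA _ (cc _ hc').
  pose D : R -> 'rV[R]_n := A (F \o c) - A (F \o c').
  pose d : R -> 'rV[R]_n := (F \o c) - (F \o c').
  have dD (u : R) : `|u| < 1 -> is_derive u 1 D (d u).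
    by move=> u1; apply: is_deriveB; [exact: dA|exact: dA'].
  have db (u : R) : `|u| < 1 -> `|d u| <= L * e.
    by move=> _; apply: le_trans (FL _ _) _; rewrite ler_pM2l.
  have z1 : `|0 : R| < 1 by rewrite normr0.
  have := mean_value_row_ball dD db z1 (k1 t).
  rewrite /D !fctE A0 A0' !subr0 /P opprD addrACA subrr add0r => /le_trans; apply.
  apply: (@le_trans _ _ (L * e * a)); first by rewrite ler_wpM2l ?kb// mulr_ge0// ltW.
  by rewrite mulrAC aL mulrC.
pose y (m : nat) : R -> 'rV[R]_n := iter m P (fun=> x0).
have yL m s t : `|y m s - y m t| <= B * `|s - t|.
  elim: m s t => [|m IH] s t; first by rewrite subrr normr0 mulr_ge0.
  by apply: PB; exact: lipschitz_continuous IH.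
have yc m : continuous (y m) := lipschitz_continuous (yL m).
have y1 m t : `|y m.+1 t - y m t| <= B / 2 ^+ m.
  elim: m t => [|m IH] t.
    have [A0 dA] := hA _ (cc _ (yc 0%N)).
    have z1 : `|0 : R| < 1 by rewrite normr0.
    have := mean_value_row_ball dA (fun u _ => FB _) z1 (k1 t).
    rewrite A0 !subr0 expr0 divr1 /= /P [x0 + _]addrC addrK => /le_trans; apply.
    by rewrite -[leRHS]mulr1 ler_wpM2l// ltW.
  have := PC (y m.+1) (y m) _ (yc _) (yc _) IH t.
  by rewrite exprSr invfM mulrA.
have /choice[c hc] t : exists l, forall m, `|l - y m t| <= 2 * B / 2 ^+ m.
  exact: row_geometric_limit.
have cL s t : `|c s - c t| <= B * `|s - t|.
  (* Replacing [c] by [y m] costs 2 B / 2^m at each of the two points. *)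
  apply: (@le_of_le_add_geometric _ _ _ (4 * B)) => m.
  have -> : c s - c t = (c s - y m s) + (y m s - y m t) + (y m t - c t).
    by rewrite !subrKA.
  apply: le_trans (ler_normD _ _) _.
  apply: le_trans (lerD (ler_normD _ _) (lexx _)) _.
  have := hc s m; have := hc t m; have := yL m s t; rewrite [`|c t - _|]distrC.
  have -> : 4 * B / 2 ^+ m = 2 * B / 2 ^+ m + 2 * B / 2 ^+ m by lra.
  lra.
have cC : continuous c := lipschitz_continuous cL.
have cP t : c t = P c t.
  apply/eqP; rewrite -subr_eq0 -normr_le0.
  apply: (@le_of_le_add_geometric _ _ _ (2 * B)) => m; rewrite add0r.
  (* The comparison uses iterate m + 1 because it is [P (y m)], to which the contraction estimate
     [PC] applies; both errors are B / 2^m * 2 / 2. *)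
  have -> : c t - P c t = (c t - y m.+1 t) + (y m.+1 t - P c t).
    by rewrite subrKA.
  apply: le_trans (ler_normD _ _) _.
  have h1 := hc t m.+1.
  have h2 : `|y m.+1 t - P c t| <= 2 * B / 2 ^+ m / 2.
    by apply: PC => // s; rewrite distrC.
  by move: h1; rewrite exprSr invfM mulrA; lra.
have [A0 dA] := hA _ (cc _ cC).
exists a => //; exists c; split; first by rewrite cP /P k0 A0 addr0.
move=> t ta.
have dPt : is_derive t 1 (cst x0 + A (F \o c)) (F (c t)).
  apply: is_derive_eq; last exact: add0r.
  by apply: is_deriveD; apply: dA; apply: lt_trans a1.
(* Near [t] the clamp is inactive, so [c] coincides there with a translate of an honest
   antiderivative of [F \o c]. *)
apply: near_eq_is_derive dPt; near=> s.
rewrite [RHS]cP /P !fctE /k clamp_id//.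
have : `|s| < a by near: s; exact: near_norm_lt.
by rewrite ltr_norml => /andP[/ltW -> /ltW ->].
Unshelve. all: by end_near. Qed.

End PicardLindelof.

(** * Local integral curves of C^1 fields on open subsets of R^n *)

Section LocalIntegralCurve.
Context {R : realType}.

Lemma is_derive_comp_diff (V W : normedModType R) (f : V -> W) (c : R -> V)
    (t : R) dc :
  differentiable f (c t) -> is_derive t 1 c dc ->
  is_derive t 1 (f \o c) ('d f (c t) dc).
Proof.
move=> df [/derivable1_diffP dc1 <-].
have dfc : differentiable (f \o c) t by apply: differentiable_comp.
apply: DeriveDef; first exact/derivable1_diffP.
by rewrite deriveE// diff_comp//= deriveE.
Qed.

Lemma is_derive_diff (V W : normedModType R) (f : V -> W) (y v : V) :
  differentiable f y -> is_derive y v f ('D_v f y).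
Proof. by move=> df; apply: derivableP; exact: diff_derivable. Qed.

Lemma is_derive_line (V : normedModType R) (x v : V) (t : R) :
  is_derive t 1 (fun s : R => x + s *: v) v.
Proof.
have d : is_derive t 1 (cst x \+ *:%R^~ v) (0 + 1 *: v).
  apply: is_deriveD.
  apply: DeriveDef; first exact/derivable1_diffP.
  by rewrite deriveE// diff_val.
by rewrite add0r scale1r in d.
Qed.

Lemma derive_sum_partial n (W : normedModType R) (f : 'rV[R]_n -> W) x v :
  differentiable f x ->
  'D_v f x = \sum_(j < n) v 0 j *: 'D_(delta_mx 0 j) f x.
Proof.
move=> df; rewrite deriveE// [in LHS](row_sum_delta v) linear_sum.
by apply: eq_bigr => j _; rewrite linearZ deriveE.
Qed.

(** By continuity the partial derivatives near [x0] exceed their norms at [x0] by at most 1. The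
    mean value bound along segments, which stay in the ball by convexity, gives the Lipschitz
    constant [\sum_j b j]. *)
Lemma C1_locally_lipschitz n (f : 'rV[R]_n -> 'rV[R]_n) (U : set 'rV[R]_n) x0 :
  open U -> U x0 -> Ck_on 1 U f ->
  exists2 r : R, 0 < r & (forall x, `|x - x0| <= r -> U x) /\
    exists L : R, forall x y, `|x - x0| <= r -> `|y - x0| <= r ->
      `|f x - f y| <= L * `|x - y|.
Proof.
move=> oU Ux0 [df cf].
pose b j := `|'D_(delta_mx 0 j) f x0| + 1.
have : \forall x \near x0,
    U x /\ forall j : 'I_n, `|'D_(delta_mx 0 j) f x| <= b j.
  near=> x; split; first by near: x; exact: open_nbhs_nbhs.
  near: x; apply: filter_forall => j; near=> x; apply/ltW; near: x.
  by apply: (cvgr_norm_lt _ (cf (delta_mx 0 j) x0 Ux0)); rewrite ltrDl.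
move=> /nbhs_ballP[e /= e0 he]; exists (e / 2); first by rewrite divr_gt0.
have {}he x : `|x - x0| <= e / 2 ->
    U x /\ forall j : 'I_n, `|'D_(delta_mx 0 j) f x| <= b j.
  move=> xe; apply: he; rewrite -ball_normE/= distrC; apply: le_lt_trans xe _.
  by rewrite ltr_pdivrMr// ltr_pMr// ltrDl.
split; first by move=> x /he[].
exists (\sum_j b j) => y x yr xr.
pose c (s : R) := x + s *: (y - x).
have cb (s : R) : 0 <= s <= 1 -> `|c s - x0| <= e / 2.
  move=> /andP[s0 s1].
  have -> : c s - x0 = (1 - s) *: (x - x0) + s *: (y - x0).
    by apply/rowP => i; rewrite !mxE; ring.
  apply: le_trans (ler_normD _ _) _; rewrite !normrZ !ger0_norm ?subr_ge0//.
  have -> : e / 2 = (1 - s) * (e / 2) + s * (e / 2) by ring.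
  by rewrite lerD// ler_wpM2l// subr_ge0.
have := @mean_value_row R n (f \o c) (fun s => 'D_(y - x) f (c s))
  ((\sum_j b j) * `|y - x|) 0 1 ler01.
have -> : (f \o c) 1 = f y by rewrite /c /= scale1r addrC subrK.
have -> : (f \o c) 0 = f x by rewrite /c /= scale0r addr0.
rewrite subr0 mulr1; apply.
- move=> u u01; have [Uc _] := he _ (cb _ u01).
  rewrite deriveE; last exact: df.
  by apply: is_derive_comp_diff; [exact: df|exact: is_derive_line].
- move=> u u01; have [Uc hb] := he _ (cb _ u01).
  rewrite derive_sum_partial; last exact: df.
  apply: le_trans (ler_norm_sum _ _ _) _; rewrite mulr_suml ler_sum// => j _.
  by rewrite normrZ mulrC ler_pM// norm_coord_le.
Unshelve. all: by end_near. Qed.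

(* Composing with the coordinatewise retraction onto a small cube makes the
   field globally Lipschitz and bounded without changing it near x0. *)
Lemma local_integral_curve n (f : 'rV[R]_n -> 'rV[R]_n) (U : set 'rV[R]_n) x0 :
  open U -> U x0 -> Ck_on 1 U f ->
  exists2 a : R, 0 < a & exists c : R -> 'rV[R]_n, c 0 = x0 /\
    forall t : R, `|t| < a -> U (c t) /\ is_derive t 1 c (f (c t)).
Proof.
move=> oU Ux0 f1; have [r r0 [rU [L fL]]] := C1_locally_lipschitz oU Ux0 f1.
pose p (x : 'rV[R]_n) : 'rV[R]_n :=
  \row_i clamp (x0 0 i - r) (x0 0 i + r) (x 0 i).
have pr x : `|p x - x0| <= r.
  apply: row_norm_le => [|i]; first exact: ltW.
  have : x0 0 i - r <= x0 0 i + r by lra.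
  by move=> /(clamp_itv (x 0 i)); rewrite !mxE ler_norml; lra.
have pL x y : `|p x - p y| <= `|x - y|.
  apply: row_norm_le => [//|i]; rewrite !mxE.
  apply: le_trans (clamp_lipschitz _ _ _ _) _.
  by have := norm_coord_le (x - y) i; rewrite !mxE.
have pid x : `|x - x0| <= r -> p x = x.
  move=> xr; apply/rowP => i; rewrite mxE clamp_id//.
  by have := le_trans (norm_coord_le (x - x0) i) xr; rewrite !mxE ler_norml; lra.
have [||a a0 [c [c0 dc]]] :=
  @picard_lindelof R n (f \o p) `|L| (`|f x0| + `|L| * r) x0.
- move=> x y; apply: le_trans (fL _ _ (pr x) (pr y)) _.
  apply: (@le_trans _ _ (`|L| * `|p x - p y|)); last by rewrite ler_wpM2l// pL.
  by rewrite ler_wpM2r// ler_norm.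
- move=> x; have -> : (f \o p) x = f x0 + (f (p x) - f x0) by rewrite addrC subrK.
  apply: le_trans (ler_normD _ _) _; rewrite lerD2l.
  apply: le_trans (fL _ _ (pr x) _) _; first by rewrite subrr normr0 ltW.
  apply: (@le_trans _ _ (`|L| * `|p x - x0|)); last by rewrite ler_wpM2l// pr.
  by rewrite ler_wpM2r// ler_norm.
(* The curve found so far integrates [f \o p]. By continuity it stays within distance r of [x0] for
   a short time, and there [p] is the identity. *)
have cc : {for 0, continuous c}.
  apply: differentiable_continuous; apply/derivable1_diffP.
  by have [] := dc 0; rewrite ?normr0.
have : \forall t \near (0 : R), `|c t - x0| <= r.
  near=> t; apply/ltW; rewrite distrC -c0; near: t.
  exact: (@cvgr_dist_lt _ _ _ _ _ c (c 0) cc r r0).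
move=> /nbhs_ballP[d /= d0 hd].
exists (Num.min a d); first by rewrite lt_min a0.
exists c; split => // t; rewrite lt_min => /andP[ta td].
have cr : `|c t - x0| <= r by apply: hd; rewrite -ball_normE/= sub0r normrN.
by split; [exact: rU|have := dc _ ta; rewrite /= pid].
Unshelve. all: by end_near. Qed.

End LocalIntegralCurve.

(** * From geodesic integral curves to the vanishing of nabla_sigma sigma *)

Section GeodesicField.
Context {R : realType} {n : nat} {M : manifold R n} (g : riemannian_metric M).
Implicit Types (phi psi : chart R n M) (x v w : 'rV[R]_n).

Lemma chart_img_setT phi : chart_img phi setT = chart_map phi @` chart_dom phi.
Proof. by rewrite /chart_img setIT. Qed.

Lemma chart_img_point phi (W : set M) p :
  chart_dom phi p -> W p -> chart_img phi W (chart_map phi p).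
Proof. by move=> pd pW; exists p. Qed.

Lemma open_chart_img_setT phi : open (chart_img phi setT).
Proof. by rewrite chart_img_setT; exact: chart_img_open. Qed.

Lemma chart_invK phi x : chart_img phi setT x ->
  chart_dom phi (chart_inv phi x) /\ chart_map phi (chart_inv phi x) = x.
Proof. by rewrite chart_img_setT => -[q qd <-]; rewrite chart_mapK. Qed.

Lemma smooth_differentiable (V W : normedModType R) (U : set V) (f : V -> W)
    (x : V) :
  smooth_on U f -> U x -> differentiable f x.
Proof. by move=> /(_ 1%N) [df _] /df. Qed.

(** Solving the equation in one chart is enough: in any other chart, the chain rule for the
    transition map matches the transformation law of [sigma]. *)
Lemma integral_curve_of_chart (sigma : vector_field M) phi (I : set R)
    (c : R -> 'rV[R]_n) : atlas phi ->
  (forall t, I t ->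
     chart_img phi setT (c t) /\ is_derive t 1 c (sigma phi (c t))) ->
  integral_curve sigma I (chart_inv phi \o c).
Proof.
move=> phiA hc t It; have [ct dct] := hc t It.
have [qd qE] := chart_invK ct.
have cc : {for t, continuous c}.
  by apply: differentiable_continuous; apply/derivable1_diffP; have [] := dct.
split=> [|psi psiA psid].
  apply: continuous_comp => //; apply: chart_inv_cont.
  by rewrite -chart_img_setT.
have cpsi : chart_img phi (chart_dom psi `&` setT) (c t).
  by rewrite setIT; exists (chart_inv phi (c t)).
have -> : sigma psi (chart_map psi ((chart_inv phi \o c) t)) =
    'd (transition phi psi) (c t) (sigma phi (c t)).
  by rewrite -(vf_transform sigma phiA psiA cpsi).
apply: (is_derive_comp_diff (f := transition phi psi)) => //.
by apply: smooth_differentiable (atlas_compat phiA psiA) _; rewrite setIT in cpsi.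
Qed.

(** Along an integral curve x' = sigma(x), hence x'' is the derivative of sigma in the direction
    sigma, and the geodesic equation at time 0 reads nabla_sigma sigma = 0 at the starting point. *)
Lemma nabla_geodesic_field (sigma : vector_field M) phi p :
  (forall (I : set R) (c : R -> M),
     open_interval I -> integral_curve sigma I c -> geodesic g I c) ->
  atlas phi -> chart_dom phi p ->
  nabla g sigma phi (chart_map phi p) (sigma phi (chart_map phi p)) = 0.
Proof.
move=> hg phiA pd; set x0 := chart_map phi p; set f := sigma phi.
have Ux0 : chart_img phi setT x0 by exact: chart_img_point.
have fs : smooth_on (chart_img phi setT) f := vf_smooth sigma phiA.
have [a a0 [c [c0 hc]]] :=
  local_integral_curve (@open_chart_img_setT phi) Ux0 (fs 1%N).
pose I : set R := [set t | `|t| < a].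
have oI : open_interval I.
  split.
    have -> : I = ball (0 : R) a; last exact: ball_open.
    by apply/seteqP; split=> t; rewrite /I -ball_normE/= sub0r normrN.
  move=> s t; rewrite /I/= !ltr_norml => /andP[s1 s2] /andP[t1 t2] u /andP[su ut].
  by rewrite ltr_norml (lt_le_trans s1 su) (le_lt_trans ut t2).
have I0 : I 0 by rewrite /I/= normr0.
have ic : integral_curve sigma I (chart_inv phi \o c).
  by apply: integral_curve_of_chart phiA _ => t /hc.
have cE t : I t -> (chart_map phi \o (chart_inv phi \o c)) t = c t.
  by move=> /hc [/chart_invK[]].
have nI (t : R) : I t -> \forall s \near t, I s by exact: near_norm_lt.
have [_] := hg I _ oI ic 0 I0.
have [d0 _] := hc 0 I0; have [q0 _] := chart_invK d0.
move=> /(_ phi phiA q0); set x := chart_map phi \o _ => -[_ _].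
have dx t : I t -> derive1 x t = f (c t).
  move=> It; rewrite derive1E; have [_ dct] := hc t It.
  have e : \forall s \near t, x s = c s by near=> s; apply: cE; near: s; exact: nI.
  by rewrite (near_eq_derive _ e); have [] := dct.
(* A second derivative at 0 requires x' = f(c) on a neighbourhood of 0, not only at 0. *)
have e : \forall s \near (0 : R), derive1 x s = (f \o c) s.
  by near=> s; apply: dx; near: s; exact: nI.
have df : differentiable f (c 0) by apply: smooth_differentiable fs _; rewrite c0.
have [_ dc0] := hc 0 I0.
have dfc := is_derive_comp_diff df dc0.
rewrite [derive1 (derive1 x) 0]derive1E (near_eq_derive _ e) dx//.
have [_ ->] := dfc.
have -> : x 0 = c 0 by exact: cE.
by rewrite -deriveE// c0.
Unshelve. all: by end_near. Qed.

End GeodesicField.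

(** * Cauchy-Schwarz, the trace inequality, and Leibniz rules for matrices *)

Section LinearAlgebra.
Context {R : realType}.

(** With A, B the sums of squares and C the sum of products, B (A B - C^2) is the sum of the squares
    of B a_i - C b_i. If B = 0, all b_i vanish and so does C. *)
Lemma cauchy_schwarz_sum (I : finType) (a b : I -> R) :
  (\sum_i a i * b i) ^+ 2 <= (\sum_i a i ^+ 2) * (\sum_i b i ^+ 2).
Proof.
set A := \sum_i a i ^+ 2; set B := \sum_i b i ^+ 2; set C := \sum_i a i * b i.
have B0 : 0 <= B by apply: sumr_ge0 => i _; exact: sqr_ge0.
have key : \sum_i (B * a i - C * b i) ^+ 2 = B * (A * B - C ^+ 2).
  transitivity (\sum_i (B ^+ 2 * a i ^+ 2 - 2 * B * C * (a i * b i)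
                        + C ^+ 2 * b i ^+ 2)).
    by apply: eq_bigr => i _; ring.
  by rewrite big_split sumrB/= -!mulr_sumr -/A -/B -/C; ring.
have : 0 <= B * (A * B - C ^+ 2).
  by rewrite -key; apply: sumr_ge0 => i _; exact: sqr_ge0.
move: B0; rewrite le_eqVlt => /predU1P[/esym Bz _|B1].
  suff -> : C = 0 by rewrite Bz mulr0 expr0n.
  apply: big1 => i _; have /eqP : b i ^+ 2 = 0.
    by apply: (psumr_eq0P _ Bz) => // j _; exact: sqr_ge0.
  by rewrite sqrf_eq0 => /eqP ->; rewrite mulr0.
by rewrite pmulr_rge0// subr_ge0.
Qed.

Lemma bilinE n (A : 'M[R]_n) v w :
  bilin A v w = \sum_i \sum_j v 0 i * A i j * w 0 j.
Proof.
rewrite /bilin mxE exchange_big/=; apply: eq_bigr => j _.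
by rewrite !mxE mulr_suml.
Qed.

Lemma bilinDl n (A B : 'M[R]_n) v w :
  bilin (A + B) v w = bilin A v w + bilin B v w.
Proof. by rewrite /bilin mulmxDr mulmxDl mxE. Qed.

Lemma bilinC n (A : 'M[R]_n) v w : bilin A^T v w = bilin A w v.
Proof.
rewrite !bilinE exchange_big/=; apply: eq_bigr => i _; apply: eq_bigr => j _.
by rewrite mxE; ring.
Qed.

(* tr S is the Frobenius product of S with the projection 1 - u^T u, whose
   squared norm is n - 1. *)
Lemma mxtrace_sq_le_of_isotropic n (S : 'M[R]_n) (u : 'rV[R]_n) :
  bilin 1%:M u u = 1 -> bilin S u u = 0 ->
  (\tr S) ^+ 2 <= (n%:R - 1) * \sum_i \sum_j S i j ^+ 2.
Proof.
move=> u1 Su.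
pose K (i j : 'I_n) : R := (i == j)%:R - u 0 i * u 0 j.
have uu : \sum_i u 0 i ^+ 2 = 1.
  rewrite -u1 /bilin mulmx1 mxE; apply: eq_bigr => i _.
  by rewrite !mxE expr2.
have dl (F : 'I_n -> 'I_n -> R) i : \sum_j (i == j)%:R * F i j = F i i.
  rewrite (bigD1 i)//= eqxx mul1r big1 ?addr0// => j /negPf ji.
  by rewrite eq_sym ji mul0r.
have tS : \sum_i \sum_j S i j * K i j = \tr S.
  transitivity (\tr S - bilin S u u); last by rewrite Su subr0.
  rewrite bilinE /mxtrace -sumrB; apply: eq_bigr => i _.
  rewrite -(dl S i) -sumrB; apply: eq_bigr => j _.
  by rewrite /K; ring.
have K2 : \sum_i \sum_j K i j ^+ 2 = n%:R - 1.
  transitivity (\sum_i (1 - 2 * u 0 i ^+ 2 + u 0 i ^+ 2 * \sum_j u 0 j ^+ 2)).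
    apply: eq_bigr => i _.
    (* Read backwards, [dl] spreads the diagonal term over [j], so that the identity can be checked
       entry by entry; the square of a Kronecker delta is itself. *)
    rewrite -(dl (fun i j => 1 - 2 * (u 0 i * u 0 j)) i) mulr_sumr -big_split/=.
    apply: eq_bigr => j _; rewrite /K.
    by case: (i == j) => /=; ring.
  rewrite uu; under eq_bigr => i _ do rewrite mulr1.
  rewrite big_split sumrB/= -mulr_sumr uu sumr_const card_ord; ring.
rewrite -tS -K2 mulrC !pair_big/=.
exact: (cauchy_schwarz_sum (fun p => S p.1 p.2) (fun p => K p.1 p.2)).
Qed.

Lemma is_derive_mulmx (V : normedModType R) m k p (A : V -> 'M[R]_(m, k))
    (B : V -> 'M[R]_(k, p)) x v dA dB :
  is_derive x v A dA -> is_derive x v B dB ->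
  is_derive x v (fun y => A y *m B y) (dA *m B x + A x *m dB).
Proof.
move=> /is_derive_mxP hA /is_derive_mxP hB; apply/is_derive_mxP => i j.
rewrite (_ : (fun _ => _) = \sum_(l < k) ((fun y => A y i l) * (fun y => B y l j))).
  have h := is_derive_sum (fun l => is_deriveM (hA i l) (hB l j)).
  apply: is_derive_eq; rewrite !mxE -big_split/=; apply: eq_bigr => l _.
  by rewrite addrC [dA i l * _]mulrC.
by apply/funext => y; rewrite mxE fct_sumE.
Qed.

Lemma is_derive_trmx (V : normedModType R) m k (A : V -> 'M[R]_(m, k)) x v dA :
  is_derive x v A dA -> is_derive x v (fun y => (A y)^T) dA^T.
Proof.
move=> /is_derive_mxP hA; apply/is_derive_mxP => i j; rewrite mxE.
by rewrite (_ : (fun _ => _) = (fun y => A y j i)) //; apply/funext => y; rewrite mxE.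
Qed.

Lemma is_derive_bilin (V : normedModType R) n (G : V -> 'M[R]_n)
    (X Y : V -> 'rV[R]_n) x v dG dX dY :
  is_derive x v G dG -> is_derive x v X dX -> is_derive x v Y dY ->
  is_derive x v (fun y => bilin (G y) (X y) (Y y))
    (bilin (G x) dX (Y x) + bilin dG (X x) (Y x) + bilin (G x) (X x) dY).
Proof.
move=> hG hX hY.
have := is_derive_mulmx (is_derive_mulmx hX hG) (is_derive_trmx hY).
move=> /is_derive_mxP /(_ 0 0) h; apply: is_derive_eq h _.
by rewrite /bilin mulmxDl 2!mxE.
Qed.

End LinearAlgebra.

(** * Algebraic rules for [bilin] *)

Section BilinAlgebra.
Context {R : realType} {n : nat}.
Implicit Types (A J : 'M[R]_n) (v w : 'rV[R]_n).

Lemma bilinBv A v v' w : bilin A (v - v') w = bilin A v w - bilin A v' w.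
Proof. by rewrite /bilin mulmxBl mulmxBl mxE [X in _ + X]mxE. Qed.

Lemma bilinBw A v w w' : bilin A v (w - w') = bilin A v w - bilin A v w'.
Proof. by rewrite -bilinC bilinBv !bilinC. Qed.

Lemma bilinNw A v w : bilin A v (- w) = - bilin A v w.
Proof. by rewrite /bilin linearN mulmxN mxE. Qed.

Lemma bilin_mulmxl A J v w : bilin A (v *m J) w = bilin (J *m A) v w.
Proof. by rewrite /bilin mulmxA. Qed.

Lemma bilin_mulmxr A J v w : bilin A v (w *m J) = bilin (A *m J^T) v w.
Proof. by rewrite /bilin trmx_mul !mulmxA. Qed.

(** Lowering an index undoes raising it: this is how the inverse metric disappears from the
    Christoffel symbols. *)
Lemma bilin_mulr_inv A v w (k : R) : A \in unitmx ->
  bilin A v (k *: (w *m (invmx A)^T)) = k * \sum_l v 0 l * w 0 l.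
Proof.
move=> uA; rewrite /bilin linearZ/= -scalemxAr mxE; congr (_ * _).
rewrite trmx_mul trmxK mulmxA (mulmxK uA) mxE.
by apply: eq_bigr => l _; rewrite mxE.
Qed.

End BilinAlgebra.

(** * The Lie derivative of the metric and the divergence in one chart *)

Section ChartComputation.
Context {R : realType} {n : nat} {M : manifold R n} (g : riemannian_metric M).
Variables (phi : chart R n M) (x : 'rV[R]_n).
Hypothesis phi_atlas : atlas phi.
Hypothesis phi_x : chart_img phi setT x.
Implicit Types (v w z : 'rV[R]_n).

Let G := g phi x.
Let dG v := 'D_v (g phi) x.

Hypothesis G_unit : G \in unitmx.

Let near_chart : \forall y \near x, chart_img phi setT y.
Proof. by apply: open_nbhs_nbhs; split => //; exact: open_chart_img_setT. Qed.

Let g_diff : differentiable (g phi) x.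
Proof. exact: smooth_differentiable (metric_smooth g phi_atlas) phi_x. Qed.

Lemma metric_tr : G^T = G.
Proof. exact: (Defs.metric_sym g phi_atlas phi_x). Qed.

(** Symmetry of the metric holds on the image of the chart only, but that image is open, so the
    symmetry can be differentiated at [x]. *)
Lemma derive_metric_tr v : (dG v)^T = dG v.
Proof.
have d := is_derive_diff v g_diff.
have dt := is_derive_trmx d.
rewrite -[LHS](@derive_val _ _ _ _ _ _ _ dt).
apply: near_eq_derive; near=> y.
by apply: (Defs.metric_sym g phi_atlas); near: y; exact: near_chart.
Unshelve. all: by end_near. Qed.

Lemma derive_metricE v i j :
  dG v i j = \sum_l v 0 l * partial_metric g phi x l i j.
Proof.
rewrite /dG derive_sum_partial// summxE; apply: eq_bigr => l _.
by rewrite mxE.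
Qed.

Lemma partial_metricC l i j :
  partial_metric g phi x l i j = partial_metric g phi x l j i.
Proof.
have /matrixP/(_ j i) := derive_metric_tr (delta_mx 0 l).
by rewrite mxE.
Qed.

(** Pairing with the metric cancels its inverse and leaves the Christoffel symbols of the first
    kind; the rest is reordering of sums. *)
Lemma christoffel_lower z v w :
  bilin G z (christoffel_form g phi x v w) =
  2^-1 * (bilin (dG v) w z + bilin (dG w) v z - bilin (dG z) v w).
Proof.
pose T := partial_metric g phi x.
(* Twice the Christoffel symbols of the first kind, contracted with [v] and [w]; raising the index
   of [C] and halving gives [christoffel_form]. *)
pose C : 'rV[R]_n :=
  \row_l \sum_i \sum_j (T i j l + T j i l - T l i j) * v 0 i * w 0 j.
have -> : christoffel_form g phi x v w = 2^-1 *: (C *m (invmx G)^T).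
  apply/rowP => k; rewrite !mxE mulr_sumr.
  under eq_bigr => i _ do under eq_bigr => j _ do
    rewrite /christoffel mulr_sumr !mulr_suml.
  under eq_bigr => i _ do rewrite exchange_big/=.
  rewrite exchange_big/=; apply: eq_bigr => l _.
  rewrite !mxE mulr_suml mulr_sumr; apply: eq_bigr => i _.
  rewrite mulr_suml mulr_sumr; apply: eq_bigr => j _.
  by rewrite /T /G; ring.
rewrite (bilin_mulr_inv _ _ _ G_unit) !bilinE; congr (_ * _).
transitivity (\sum_i \sum_j \sum_l
    z 0 l * (T i j l + T j i l - T l i j) * v 0 i * w 0 j).
  under eq_bigr => l _ do rewrite !mxE mulr_sumr.
  rewrite exchange_big/=; apply: eq_bigr => i _.
  under eq_bigr => l _ do rewrite mulr_sumr.
  rewrite exchange_big/=; apply: eq_bigr => j _; apply: eq_bigr => l _; ring.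
transitivity (\sum_i \sum_j \sum_l (w 0 j * (v 0 i * T i j l) * z 0 l) +
              \sum_i \sum_j \sum_l (v 0 i * (w 0 j * T j i l) * z 0 l) -
              \sum_i \sum_j \sum_l (v 0 i * (z 0 l * T l i j) * w 0 j)).
  rewrite -big_split -sumrB/=; apply: eq_bigr => i _.
  rewrite -big_split -sumrB/=; apply: eq_bigr => j _.
  by rewrite -big_split -sumrB/=; apply: eq_bigr => l _; ring.
congr (_ + _ - _).
- rewrite exchange_big/=; apply: eq_bigr => j _; rewrite exchange_big/=.
  apply: eq_bigr => l _; rewrite derive_metricE mulr_sumr mulr_suml.
  by [].
- apply: eq_bigr => i _; rewrite exchange_big/=; apply: eq_bigr => l _.
  by rewrite derive_metricE mulr_sumr mulr_suml.
- apply: eq_bigr => i _; apply: eq_bigr => j _.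
  by rewrite derive_metricE mulr_sumr mulr_suml.
Qed.

(** In the contraction Gamma^i_ij two of the three derivatives of the metric cancel by symmetry,
    leaving half of g^il d_j g_il. *)
Lemma divergenceE (alpha : vector_field M) :
  divergence g alpha phi x = \tr (jacobian (alpha phi) x)
    + 2^-1 * \tr (dG (alpha phi x) *m invmx G).
Proof.
pose T := partial_metric g phi x; pose H := invmx G; pose a := alpha phi x.
have a_diff : differentiable (alpha phi) x.
  exact: smooth_differentiable (vf_smooth alpha phi_atlas) phi_x.
have HC i j : H i j = H j i.
  by rewrite -[in LHS](_ : H^T = H) ?mxE// /H trmx_inv metric_tr.
rewrite /divergence /nabla.
under eq_bigr => i _ do rewrite mxE.
rewrite big_split/=; congr (_ + _).
  by apply: eq_bigr => i _; rewrite deriveEjacobian// -rowE mxE.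
transitivity (\sum_i \sum_j christoffel g phi x i i j * a 0 j).
  apply: eq_bigr => i _; rewrite mxE (bigD1 i)//= [X in _ + X]big1 ?addr0.
    by apply: eq_bigr => j _; rewrite mxE !eqxx mulr1.
  move=> k /negPf ki; rewrite big1// => j _.
  by rewrite mxE ki andbF mulr0 mul0r.
rewrite exchange_big/= /mxtrace mulr_sumr.
transitivity (\sum_j 2^-1 * \sum_i \sum_l a 0 j * T j i l * H l i).
  apply: eq_bigr => j _; rewrite -mulr_suml.
  rewrite /christoffel -!mulr_sumr -mulrA; congr (_ * _).
  transitivity ((\sum_i \sum_l H i l * T i j l + \sum_i \sum_l H i l * T j i l
                 - \sum_i \sum_l H i l * T l i j) * a 0 j).
    rewrite -big_split -sumrB/=; congr (_ * _); apply: eq_bigr => i _.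
    by rewrite -big_split -sumrB/=; apply: eq_bigr => l _; rewrite /T; ring.
  (* This is the cancellation: exchange the names of [i] and [l], then use the symmetry of [H] and
     of the metric. *)
  have -> : \sum_i \sum_l H i l * T i j l = \sum_i \sum_l H i l * T l i j.
    rewrite exchange_big/=; apply: eq_bigr => i _; apply: eq_bigr => l _.
    by rewrite HC /T [in LHS]partial_metricC.
  rewrite addrAC subrr add0r mulr_suml; apply: eq_bigr => i _.
  rewrite mulr_suml; apply: eq_bigr => l _.
  by rewrite HC; ring.
rewrite -mulr_sumr -[RHS]mulr_sumr; congr (_ * _).
rewrite exchange_big/=; apply: eq_bigr => i _; rewrite mxE exchange_big/=.
apply: eq_bigr => l _.
by rewrite derive_metricE mulr_suml.
Qed.

(** The components of L_alpha g in the chart. Since [jacobian] acts on row vectors from the right,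
    its entry (i, k) is d_i alpha^k, hence the side on which each factor [G] stands. *)
Definition lie_matrix (alpha : vector_field M) : 'M[R]_n :=
  dG (alpha phi x) + jacobian (alpha phi) x *m G
  + G *m (jacobian (alpha phi) x)^T.

(** By the Leibniz rule the derivatives of [X] and [Y] along [alpha] cancel against those in the
    brackets, which shows that L_alpha g is tensorial. *)
Lemma lie_metricE (alpha : vector_field M) (W : set M)
    (X Y : vector_field_on W) : chart_img phi W x ->
  lie_metric g alpha X Y phi x = bilin (lie_matrix alpha) (X phi x) (Y phi x).
Proof.
move=> Wx.
have a_diff := smooth_differentiable (vf_smooth alpha phi_atlas) phi_x.
have X_diff := smooth_differentiable (vf_smooth X phi_atlas) Wx.
have Y_diff := smooth_differentiable (vf_smooth Y phi_atlas) Wx.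
pose a := alpha phi x.
have := is_derive_bilin (is_derive_diff a g_diff) (is_derive_diff a X_diff)
  (is_derive_diff a Y_diff).
rewrite /lie_metric /lie_bracket -/a => -[_].
rewrite -[fun y => bilin _ _ _]/(inner g X Y phi) => ->.
rewrite !(deriveEjacobian _ a_diff) /lie_matrix -/G -/a -/(dG a).
rewrite !bilinBv !bilinBw !bilinDl !bilin_mulmxl !bilin_mulmxr.
ring.
Qed.

(** Differentiate g(alpha, sigma) = 0 along sigma and replace the derivative of sigma by
    -Gamma(sigma, sigma). By [christoffel_lower] the terms in [dG s] cancel, and what remains is
    half of the claimed quantity. *)
Lemma lie_matrix_geodesic (alpha sigma : vector_field M) :
  orthogonal_fields g alpha sigma ->
  nabla g sigma phi x (sigma phi x) = 0 ->
  bilin (lie_matrix alpha) (sigma phi x) (sigma phi x) = 0.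
Proof.
move=> orth; set s := sigma phi x; rewrite /nabla -/s => /eqP.
rewrite addr_eq0 => /eqP ds.
have a_diff := smooth_differentiable (vf_smooth alpha phi_atlas) phi_x.
have s_diff := smooth_differentiable (vf_smooth sigma phi_atlas) phi_x.
have [_] := is_derive_bilin (is_derive_diff s g_diff) (is_derive_diff s a_diff)
  (is_derive_diff s s_diff).
rewrite -[fun y => bilin _ _ _]/(inner g alpha sigma phi).
have e : \forall y \near x, inner g alpha sigma phi y = cst 0 y.
  by near=> y; apply: orth => //; near: y; exact: near_chart.
rewrite (near_eq_derive _ e) derive_cst ds bilinNw christoffel_lower.
rewrite (deriveEjacobian _ a_diff) -/s -/G -/(dG s) bilin_mulmxl.
rewrite -[bilin (dG s) s _]bilinC derive_metric_tr.
have -> : bilin (lie_matrix alpha) s s =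
    bilin (dG (alpha phi x)) s s + 2 * bilin (jacobian (alpha phi) x *m G) s s.
  rewrite /lie_matrix !bilinDl -[bilin (G *m _) _ _]bilinC trmx_mul trmxK metric_tr.
  by ring.
move: (bilin (dG (alpha phi x)) s s) (bilin (_ *m G) s s) (bilin (dG s) _ s).
by move=> *; lra.
Unshelve. all: by end_near. Qed.

(** Each of the two Jacobian terms contributes the trace of the Jacobian, and the term in [dG] is
    twice the metric part of [divergenceE]. *)
Lemma mxtrace_lie_matrix (alpha : vector_field M) :
  \tr (lie_matrix alpha *m invmx G) = 2 * divergence g alpha phi x.
Proof.
rewrite divergenceE /lie_matrix !mulmxDl !linearD/= mulmxK//.
rewrite [\tr (G *m _ *m _)]mxtrace_mulC mulmxA mulVmx// mul1mx mxtrace_tr.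
by field.
Qed.

End ChartComputation.

(** * The inequality, by passing to the orthonormal frame *)

Theorem proposition2p5 (R : realType) (n : nat) (M : manifold R n)
    (g : riemannian_metric M) (sigma : vector_field M)
    (sigma_unit : unit_field g sigma)
    (sigma_geodesic : forall (I : set R) (c : R -> M),
       open_interval I -> integral_curve sigma I c -> geodesic g I c)
    (alpha : vector_field M) (alpha_orth : orthogonal_fields g alpha sigma)
    (p : M) (phi : chart R n M) (phi_atlas : atlas phi)
    (phi_p : chart_dom phi p)
    (W : set M) (W_open : open W) (W_p : W p)
    (E : 'I_n -> vector_field_on W) (E_orthonormal : orthonormal_frame g E) :
  (n%:R - 1) * lie_metric_sqnorm g alpha E phi (chart_map phi p) >=
  4 * divergence g alpha phi (chart_map phi p) ^+ 2.
Proof.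
set x := chart_map phi p.
have xT : chart_img phi setT x by exact: chart_img_point.
have xW : chart_img phi W x by exact: chart_img_point.
pose G := g phi x; pose P : 'M[R]_n := \matrix_(i, j) E i phi x 0 j.
have rowE i : row i P = E i phi x by apply/rowP => j; rewrite !mxE.
have entry (A : 'M[R]_n) i j :
    (P *m A *m P^T) i j = bilin A (E i phi x) (E j phi x).
  by rewrite -!rowE /bilin tr_row -!row_mul !mxE; apply: eq_bigr => k _; rewrite !mxE.
have PGP : P *m G *m P^T = 1%:M.
  by apply/matrixP => i j; rewrite entry mxE; exact: E_orthonormal.
(* Invertibility of the metric matrix is read off from the frame, as a factor of an identity
   matrix. *)
have G_unit : G \in unitmx.
  have [] := mulmx1_unit PGP.
  by rewrite unitmx_mul => /andP[].
have GPP : G *m P^T *m P = 1%:M by apply: mulmx1C; rewrite mulmxA.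
have PP : P^T *m P = invmx G.
  by rewrite -[RHS]mulmx1 -GPP !mulmxA mulVmx// mul1mx.
have GT : G^T = G := metric_tr g phi_atlas xT.
pose L := lie_matrix g phi x alpha; pose s := sigma phi x.
(* The coordinates g(sigma, E_i) of sigma in the frame; [uP] recovers sigma from them. *)
pose u := s *m G *m P^T.
have uP : u *m P = s by rewrite /u -!mulmxA [P^T *m P]PP mulmxV// mulmx1.
have u1 : bilin 1%:M u u = 1.
  rewrite /bilin mulmx1 {2}/u !trmx_mul trmxK GT !mulmxA uP.
  exact: sigma_unit.
have Lu : bilin (P *m L *m P^T) u u = 0.
  rewrite -bilin_mulmxr uP /bilin !mulmxA uP.
  apply: lie_matrix_geodesic => //.
  exact: nabla_geodesic_field.
have := mxtrace_sq_le_of_isotropic u1 Lu.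
(* The trace is cyclic and P^T P is the inverse metric, so the trace in the frame is the metric
   trace of L_alpha g. *)
have -> : \tr (P *m L *m P^T) = 2 * divergence g alpha phi x.
  by rewrite mxtrace_mulC mulmxA mxtrace_mulC PP mxtrace_lie_matrix.
rewrite exprMn -natrX /lie_metric_sqnorm => /le_trans; apply.
under eq_bigr => i _ do under eq_bigr => j _ do rewrite entry.
under [X in _ <= _ * X]eq_bigr => i _ do
  under eq_bigr => j _ do rewrite lie_metricE//.
by [].
Qed.
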